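(* Let $\mathbf{X}$ be a random vector in $\mathbb{R}^d$, $u:\mathbb{R}^d\to\mathbb{R}$ continuously differentiable, $\Phi\in C^1(\mathbb{R}^d,\mathbb{R}^K)$, $\mathcal{G}_m$ a set of maps in $C^1(\mathbb{R}^d,\mathbb{R}^m)$ and $1\le j\le m$. For all $g\in\mathcal{G}_m$, $h\in\mathcal{G}_{m,g}^{(j)}$ and $G_j\in\mathbb{R}^K$ such that $h_j=G_j^T\Phi$, it holds $$\mathcal{L}_{m,j}(h)=G_j^TH_{g,j}G_j,$$ where $H_{g,j}=H_{g,j}^{(1)}-H_{g,j}^{(2)}\in\mathbb{R}^{K\times K}$ is a positive semi-definite matrix with $$H_{g,j}^{(1)}:=\mathbb{E}\big[\|\Pi^\perp_{\nabla g_{-j}(\mathbf{X})}\nabla u(\mathbf{X})\|_2^2\,\nabla\Phi(\mathbf{X})^T\,\Pi^\perp_{\nabla g_{-j}(\mathbf{X})}\nabla\Phi(\mathbf{X})\big],$$ $$H_{g,j}^{(2)}:=\mathbb{E}\big[\nabla\Phi(\mathbf{X})^T\,v_{g,j}(\mathbf{X})\,v_{g,j}(\mathbf{X})^T\,\nabla\Phi(\mathbf{X})\big],\qquad v_{g,j}(\mathbf{x})=\Pi^\perp_{\nabla g_{-j}(\mathbf{x})}\nabla u(\mathbf{x}),$$ which depend on $u$, $\Phi$ and $g_{-j}$.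
   Context: Jacobians are $\nabla g(\mathbf{x})=(\partial g_j/\partial x_i(\mathbf{x}))_{i,j}\in\mathbb{R}^{d\times m}$ and similarly $\nabla\Phi(\mathbf{x})\in\mathbb{R}^{d\times K}$. For a matrix or vector $M$ with $d$ rows, $\Pi^\perp_M$ is the orthogonal projector of $\mathbb{R}^d$ onto the orthogonal complement of the column span of $M$. $g_{-j}$ denotes the $m-1$ components of $g$ other than $g_j$ (if $m=1$, $\Pi^\perp_{\nabla g_{-j}}=I_d$), and $$\mathcal{G}_{m,g}^{(j)}:=\{h\in\mathcal{G}_m:h_{-j}=g_{-j}\},\quad w_{g,j}(\mathbf{x}):=\Pi^\perp_{\nabla g_{-j}(\mathbf{x})}\nabla g_j(\mathbf{x}),\quad v_{g,j}(\mathbf{x}):=\Pi^\perp_{\nabla g_{-j}(\mathbf{x})}\nabla u(\mathbf{x}),$$ $$\mathcal{L}_{m,j}(g):=\mathbb{E}\big[\|v_{g,j}(\mathbf{X})\|_2^2\,\|\Pi^\perp_{v_{g,j}(\mathbf{X})}w_{g,j}(\mathbf{X})\|_2^2\big].$$ It is assumed that $\mathbb{E}[\|\nabla u(\mathbf{X})\|_2^2\|\nabla\Phi(\mathbf{X})\|_F^2]<\infty$, so that the matrices are well defined. *)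

(* Defs.v *)
From HB Require Import structures.
From mathcomp Require Import all_boot all_order all_algebra.
From mathcomp Require Import all_classical all_reals all_analysis.

Set Implicit Arguments.
Unset Strict Implicit.
Unset Printing Implicit Defensive.

Import Order.TTheory GRing.Theory Num.Theory.
Import numFieldNormedType.Exports.

Local Open Scope classical_set_scope.
Local Open Scope ring_scope.

(* Conventions: points of R^d and values of vector-valued maps are row vectors,
   so that the library Jacobian 'J f x : 'M_(d, n), whose (i, j) entry is the
   partial derivative of f_j along x_i, has one column per component of f.
   Gradients are column vectors. *)

Section Deterministic.
Context {R : realType}.

(* Matrices carry the sup norm in the library, hence these definitions. *)
Definition norm2 d (x : 'cV[R]_d) : R := Num.sqrt (\sum_i x i 0 ^+ 2).

Definition normF d n (A : 'M[R]_(d, n)) : R :=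
  Num.sqrt (\sum_i \sum_j A i j ^+ 2).

Definition psd n (A : 'M[R]_n) : Prop :=
  A^T = A /\ forall x : 'cV[R]_n, 0 <= (x^T *m A *m x) 0 0.

Definition gradient d (f : 'rV[R]_d -> R) (x : 'rV[R]_d) : 'cV[R]_d :=
  \col_i 'D_(delta_mx 0 i) f x.

(* As the domain is finite dimensional, pointwise continuity of the
   differential in x is the same as continuity for the operator norm. *)
Definition C1 d (V : normedModType R) (f : 'rV[R]_d -> V) : Prop :=
  (forall x, differentiable f x) /\
  (forall v, continuous (fun x => 'd f x v)).

(* The projector onto the orthogonal complement of the column span of M.
   Subspaces are row spaces in the library: kermx M is {z | z *m M = 0}, i.e.
   that orthogonal complement, << M^T >> is the column span of M, and proj_mx acts
   on row vectors, whence the final transposition. *)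
Definition projperp d n (M : 'M[R]_(d, n)) : 'M[R]_d :=
  (proj_mx (kermx M) (<< M^T >>)%MS)^T.

Lemma projperpP d n (M : 'M[R]_(d, n)) (x : 'cV[R]_d) :
  M^T *m (projperp M *m x) = 0 /\
  exists c : 'cV[R]_n, x = projperp M *m x + M *m c.
Proof.
have dir : (kermx M :&: << M^T >> = 0)%MS.
  apply/eqP/rowV0P => v; rewrite sub_capmx genmxE.
  move=> /andP[/sub_kermxP vM /submxP[c vc]].
  have vv : v *m v^T = 0 by rewrite {2}vc trmx_mul trmxK mulmxA vM mul0mx.
  apply/rowP => i; rewrite mxE; apply/eqP; rewrite -sqrf_eq0; apply/eqP.
  have := congr1 (fun A : 'M[R]_1 => A 0 0) vv; rewrite !mxE => /eqP.
  rewrite psumr_eq0; last by move=> k _; rewrite mxE -expr2 sqr_ge0.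
  by move/allP/(_ i (mem_index_enum i)); rewrite mxE -expr2 => /eqP.
have full : (x^T <= kermx M + << M^T >>)%MS.
  apply: submx_full; rewrite /row_full.
  have /mxdirect_addsP := dir; rewrite mxdirectE /= => /eqP ->.
  by rewrite mxrank_ker mxrank_gen mxrank_tr subnK // rank_leq_row.
split.
  apply: trmx_inj; rewrite trmx_mul trmxK trmx0 trmx_mul trmxK.
  exact/sub_kermxP/proj_mx_sub.
have := proj_mx_compl_sub full; rewrite genmxE => /submxP[c Ec].
exists c^T; apply: trmx_inj; rewrite linearD /= !trmx_mul !trmxK -Ec.
by rewrite addrC subrK.
Qed.

(* g_{-j}; for m = 1 it takes values in 'rV_0, and projperp of its Jacobian
   is the identity. *)
Definition others d m (j : 'I_m) (g : 'rV[R]_d -> 'rV[R]_m) :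
    'rV[R]_d -> 'rV[R]_m.-1 :=
  fun x => col' j (g x).

Definition same_others d m (Gm : set ('rV[R]_d -> 'rV[R]_m)) (j : 'I_m)
    (g : 'rV[R]_d -> 'rV[R]_m) : set ('rV[R]_d -> 'rV[R]_m) :=
  [set h | Gm h /\ others j h = others j g].

(* In vvec, H1, H2 and H below, the argument g' stands for g_{-j}. *)
Definition vvec d n (u : 'rV[R]_d -> R) (g' : 'rV[R]_d -> 'rV[R]_n)
    (x : 'rV[R]_d) : 'cV[R]_d :=
  projperp ('J g' x) *m gradient u x.

Definition wvec d m (g : 'rV[R]_d -> 'rV[R]_m) (j : 'I_m)
    (x : 'rV[R]_d) : 'cV[R]_d :=
  projperp ('J (others j g) x) *m gradient (fun y => g y 0 j) x.

End Deterministic.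

Section Random.
Context {R : realType} {disp : measure_display} {T : measurableType disp}.
Variable P : probability T R.

(* Measurability for the Borel sigma-algebra of R^d. *)
Definition random_vector d (X : T -> 'rV[R]_d) : Prop :=
  measurable_fun [set: T] (X : T -> g_sigma_algebraType (@open 'rV[R]_d)).

(* Meaningful when all entries are integrable; for H1 and H2 each entry is bounded
   by |grad u(X)|^2 |grad Phi(X)|_F^2, whose expectation is assumed finite. *)
Definition Emx m n (A : T -> 'M[R]_(m, n)) : 'M[R]_(m, n) :=
  \matrix_(i, k) fine ('E_P[fun t => A t i k]).

Definition loss d m (X : T -> 'rV[R]_d) (u : 'rV[R]_d -> R) (j : 'I_m)
    (g : 'rV[R]_d -> 'rV[R]_m) : \bar R :=
  'E_P[fun t =>
    let v := vvec u (others j g) (X t) in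
    norm2 v ^+ 2 * norm2 (projperp v *m wvec g j (X t)) ^+ 2].

Definition H1 d K n (X : T -> 'rV[R]_d) (u : 'rV[R]_d -> R)
    (Phi : 'rV[R]_d -> 'rV[R]_K) (g' : 'rV[R]_d -> 'rV[R]_n) : 'M[R]_K :=
  Emx (fun t =>
    norm2 (projperp ('J g' (X t)) *m gradient u (X t)) ^+ 2 *:
      (('J Phi (X t))^T *m projperp ('J g' (X t)) *m 'J Phi (X t))).

Definition H2 d K n (X : T -> 'rV[R]_d) (u : 'rV[R]_d -> R)
    (Phi : 'rV[R]_d -> 'rV[R]_K) (g' : 'rV[R]_d -> 'rV[R]_n) : 'M[R]_K :=
  Emx (fun t =>
    ('J Phi (X t))^T *m vvec u g' (X t) *m (vvec u g' (X t))^T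
      *m 'J Phi (X t)).

Definition H d K n (X : T -> 'rV[R]_d) (u : 'rV[R]_d -> R)
    (Phi : 'rV[R]_d -> 'rV[R]_K) (g' : 'rV[R]_d -> 'rV[R]_n) : 'M[R]_K :=
  H1 X u Phi g' - H2 X u Phi g'.

End Random.

(* Main.v *)
Require Import Defs.
From HB Require Import structures.
From mathcomp Require Import all_boot all_order all_algebra.
From mathcomp Require Import all_classical all_reals all_analysis.
From mathcomp Require Import measurable_realfun.
From mathcomp Require Import ring lra.
Import Order.TTheory GRing.Theory Num.Theory.
Import numFieldNormedType.Exports.
Set Implicit Arguments.
Unset Strict Implicit.
Unset Printing Implicit Defensive.
Local Open Scope classical_set_scope.
Local Open Scope ring_scope.

(** Fix x, write Q for the projector onto the orthogonal complement of the
    columns of the Jacobian of g_{-j}, B for the Jacobian of Phi, and put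
    v = Q grad u. If h_{-j} = g_{-j} and h_j = G^T Phi, then grad h_j = B G, so
    that w_{h,j} = Q B G. The projector along a vector satisfies
    [|v|^2 |Pi_v w|^2 = |v|^2 |w|^2 - <v, w>^2] (dotc_projperp_col), and as Q
    is a symmetric idempotent, the right-hand side is the quadratic form in G
    of the matrix [|v|^2 B^T Q B - B^T v v^T B] (loss_integrand_quad). Being
    equal to a product of squares, this form is nonnegative. Both claims follow
    by taking expectations entrywise, provided that the entries are
    integrable.

    Domination: A1 = |v|^2 B^T Q B and A2 = B^T v v^T B are both positive
    semi-definite, and so is A1 - A2. An entry of a positive semi-definite
    matrix is bounded by the trace (psd_entry_le_trace), whence all entries of
    A1 and A2 are bounded by tr A1 <= |grad u|^2 |B|_F^2, which has a finite
    expectation.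

    Measurability: the first derivatives are continuous functions of X. The
    projector is not a continuous function of the matrix, as the rank may jump,
    but it is a measurable one: by Gram-Schmidt it is obtained from the columns
    by finitely many ring operations and inversions of real numbers, the
    inverse of 0 being 0 (projperp_projcols, measurable_projperp). *)

(** * Euclidean inner product and matrices *)

(** Euclidean inner product of column vectors. *)
Definition dotc (R : realType) d (x y : 'cV[R]_d) : R := (x^T *m y) 0 0.

Lemma trmx_mul_dotc (R : realType) d (x y : 'cV[R]_d) :
  x^T *m y = (dotc x y)%:M.
Proof. by rewrite /dotc -mx11_scalar. Qed.

Lemma dotcE (R : realType) d (x y : 'cV[R]_d) :
  dotc x y = \sum_i x i 0 * y i 0.
Proof. by rewrite /dotc mxE; apply: eq_bigr => i _; rewrite mxE. Qed.

Lemma dotcC (R : realType) d (x y : 'cV[R]_d) : dotc x y = dotc y x.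
Proof. by rewrite !dotcE; apply: eq_bigr => i _; rewrite mulrC. Qed.

Lemma dotcBr (R : realType) d (x y z : 'cV[R]_d) :
  dotc x (y - z) = dotc x y - dotc x z.
Proof. by rewrite /dotc mulmxBr !mxE. Qed.

Lemma dotcDr (R : realType) d (x y z : 'cV[R]_d) :
  dotc x (y + z) = dotc x y + dotc x z.
Proof. by rewrite /dotc mulmxDr !mxE. Qed.

Lemma dotcZr (R : realType) d a (x y : 'cV[R]_d) :
  dotc x (a *: y) = a * dotc x y.
Proof. by rewrite /dotc -scalemxAr mxE. Qed.

Lemma dotc_ge0 (R : realType) d (x : 'cV[R]_d) : 0 <= dotc x x.
Proof. by rewrite dotcE sumr_ge0// => i _; rewrite -expr2 sqr_ge0. Qed.

Lemma dotc_eq0 (R : realType) d (x : 'cV[R]_d) : (dotc x x == 0) = (x == 0).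
Proof.
apply/eqP/eqP => [|->]; last by rewrite /dotc mulmx0 mxE.
rewrite dotcE => /psumr_eq0P x0; apply/colP => i; rewrite mxE.
apply/eqP; rewrite -sqrf_eq0 expr2; apply/eqP/x0 => // k _.
by rewrite -expr2 sqr_ge0.
Qed.

Lemma norm2_sqr (R : realType) d (x : 'cV[R]_d) : norm2 x ^+ 2 = dotc x x.
Proof.
rewrite dotcE /norm2 sqr_sqrtr.
  by apply: eq_bigr => i _; rewrite expr2.
by apply: sumr_ge0 => i _; rewrite sqr_ge0.
Qed.

Lemma normF_sqr (R : realType) d n (A : 'M[R]_(d, n)) :
  normF A ^+ 2 = \sum_k dotc (col k A) (col k A).
Proof.
rewrite /normF sqr_sqrtr.
  rewrite exchange_big; apply: eq_bigr => k _; rewrite dotcE.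
  by apply: eq_bigr => i _; rewrite !mxE expr2.
by apply: sumr_ge0 => i _; apply: sumr_ge0 => k _; rewrite sqr_ge0.
Qed.

Lemma mulmx_dotc (R : realType) d n (M : 'M[R]_(d, n)) (x : 'cV[R]_d)
    (y : 'cV[R]_n) :
  dotc x (M *m y) = dotc (M^T *m x) y.
Proof. by rewrite /dotc trmx_mul trmxK mulmxA. Qed.

Lemma delta_quadE (R : realType) m n (A : 'M[R]_(m, n)) i k :
  ((delta_mx i 0 : 'cV_m)^T *m A *m (delta_mx k 0 : 'cV_n)) 0 0 = A i k.
Proof. by rewrite trmx_delta -rowE -colE !mxE. Qed.

Lemma mx_bilinearE (R : realType) m n (A : 'M[R]_(m, n)) (x : 'cV[R]_m)
    (y : 'cV[R]_n) :
  (x^T *m A *m y) 0 0 = \sum_p (x p.1 0 * y p.2 0) * A p.1 p.2.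
Proof.
rewrite -(pair_bigA _ (fun i k => (x i 0 * y k 0) * A i k)) /= -mulmxA mxE.
apply: eq_bigr => i _; rewrite !mxE mulr_sumr; apply: eq_bigr => k _.
by rewrite -[RHS]mulrA [y k 0 * _]mulrC.
Qed.

(** Matrices acting alike on the canonical basis are equal. *)
Lemma eq_mulmx_delta (R : realType) m n (A B : 'M[R]_(m, n)) :
  (forall k, A *m delta_mx k 0 = B *m delta_mx k 0 :> 'cV_m) -> A = B.
Proof.
move=> AB; apply/matrixP => i k.
by move/(congr1 (fun v : 'cV_m => v i 0)) : (AB k); rewrite -!colE !mxE.
Qed.

(** * The orthogonal projector *)

(** The two properties that characterize the orthogonal projector: its range
    is orthogonal to the columns of M, and it differs from the identity by a
    map into their span. *)
Lemma projperp_unique (R : realType) d n (M : 'M[R]_(d, n)) (Q : 'M[R]_d)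
    (C : 'M[R]_(n, d)) :
  M^T *m Q = 0 -> 1%:M = Q + M *m C -> projperp M = Q.
Proof.
move=> MQ QC; apply: eq_mulmx_delta => k.
move: (delta_mx k 0) => x {k}.
have [MP [c xPc]] := projperpP M x.
apply/eqP; rewrite -subr_eq0 -dotc_eq0; apply/eqP.
(* The difference lies in the span of the columns of M, to which both of its
   terms are orthogonal. *)
have {2}-> : projperp M *m x - Q *m x = M *m (C *m x - c).
  have xQC : x = Q *m x + M *m (C *m x) by rewrite mulmxA -mulmxDl -QC mul1mx.
  rewrite mulmxBr; apply/eqP; rewrite subr_eq addrAC [_ + Q *m x]addrC -xQC.
  by rewrite eq_sym subr_eq -xPc.
by rewrite mulmx_dotc mulmxBr MP mulmxA MQ mul0mx subr0 /dotc trmx0 mul0mx mxE.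
Qed.

Lemma projperp_range (R : realType) d n (M : 'M[R]_(d, n)) :
  exists C, 1%:M = projperp M + M *m C.
Proof.
have /fin_all_exists[c xc] : forall k, exists c : 'cV[R]_n,
    delta_mx k 0 = projperp M *m delta_mx k 0 + M *m c.
  by move=> k; case: (projperpP M (delta_mx k 0)).
exists (\matrix_(i, k) c k i 0); apply: eq_mulmx_delta => k.
rewrite mul1mx mulmxDl -mulmxA -[X in M *m X]colE [LHS]xc; congr (_ + _ *m _).
by apply/matrixP => i l; rewrite ord1 !mxE.
Qed.

Lemma trmx_mul_projperp (R : realType) d n (M : 'M[R]_(d, n)) :
  M^T *m projperp M = 0.
Proof.
apply: eq_mulmx_delta => k; rewrite mul0mx -mulmxA.
by case: (projperpP M (delta_mx k 0)).
Qed.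

Lemma trmx_projperp (R : realType) d n (M : 'M[R]_(d, n)) :
  (projperp M)^T = projperp M.
Proof.
have [C EC] := projperp_range M.
have PM : (projperp M)^T *m M = 0.
  by apply: trmx_inj; rewrite trmx_mul trmxK trmx_mul_projperp trmx0.
have PP : (projperp M)^T = (projperp M)^T *m projperp M.
  by rewrite -[LHS]mulmx1 EC mulmxDr mulmxA PM mul0mx addr0.
(* Without its argument, trmxK would match the transpose hidden in the
   definition of projperp. *)
by have := congr1 trmx PP; rewrite trmx_mul (trmxK (projperp M)) -PP => <-.
Qed.

Lemma projperp_idem (R : realType) d n (M : 'M[R]_(d, n)) :
  projperp M *m projperp M = projperp M.
Proof.
have [C EC] := projperp_range M.
have PM : projperp M *m M = 0.
  by rewrite -trmx_projperp; apply: trmx_inj;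
    rewrite trmx_mul trmxK trmx_mul_projperp trmx0.
by rewrite -[RHS]mulmx1 EC mulmxDr mulmxA PM mul0mx addr0.
Qed.

Lemma dotc_projperp (R : realType) d n (M : 'M[R]_(d, n)) (x y : 'cV[R]_d) :
  dotc (projperp M *m x) (projperp M *m y) = dotc x (projperp M *m y).
Proof.
by rewrite -{1}trmx_projperp -mulmx_dotc mulmxA projperp_idem.
Qed.

(** An orthogonal projector is a contraction. *)
Lemma dotc_projperp_le (R : realType) d n (M : 'M[R]_(d, n)) (x : 'cV[R]_d) :
  dotc (projperp M *m x) (projperp M *m x) <= dotc x x.
Proof.
have := dotc_ge0 (x - projperp M *m x).
rewrite dotcBr ![dotc (_ - _) _]dotcC !dotcBr dotc_projperp.
rewrite (dotcC (_ *m _)); lra.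
Qed.

(** The formula also holds for v = 0, since 0^-1 = 0. *)
Lemma projperp_col (R : realType) d (v : 'cV[R]_d) :
  projperp v = 1%:M - (dotc v v)^-1 *: (v *m v^T).
Proof.
apply: (@projperp_unique _ _ _ _ _ ((dotc v v)^-1 *: v^T)); last first.
  by rewrite -scalemxAr subrK.
have [->|v0] := eqVneq v 0; first by rewrite trmx0 mul0mx.
rewrite mulmxBr mulmx1 -scalemxAr mulmxA trmx_mul_dotc mul_scalar_mx scalerA.
by rewrite mulVf ?dotc_eq0// scale1r subrr.
Qed.

(** Lagrange's identity: multiplying by |v|^2 removes the denominator of
    projperp v, and the case v = 0 with it. *)
Lemma dotc_projperp_col (R : realType) d (v w : 'cV[R]_d) :
  dotc v v * dotc (projperp v *m w) (projperp v *m w) =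
  dotc v v * dotc w w - dotc v w ^+ 2.
Proof.
rewrite dotc_projperp projperp_col mulmxBl mul1mx dotcBr.
have [->|v0] := eqVneq v 0.
  by rewrite /dotc trmx0 !mul0mx mxE !mul0r expr0n subr0.
have v0' : dotc v v != 0 by rewrite dotc_eq0.
rewrite -scalemxAl dotcZr -mulmxA trmx_mul_dotc mul_mx_scalar dotcZr.
by rewrite (dotcC w v) mulrBr !mulrA divff// mul1r expr2.
Qed.

(** * Gram-Schmidt formula for the projector *)

(** The orthogonal projector onto the complement of the columns of M with
    indices in s, built by removing one column at a time: q is the part of
    column k that is orthogonal to the columns already treated. If q = 0, the
    convention 0^-1 = 0 makes the step trivial, as it should be. *)
Fixpoint projcols (R : realType) d n (M : 'M[R]_(d, n)) (s : seq 'I_n) :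
    'M[R]_d :=
  if s is k :: s' then
    let q := projcols M s' *m col k M in
    projcols M s' - (dotc q q)^-1 *: (q *m q^T)
  else 1%:M.

Lemma projcols_spec (R : realType) d n (M : 'M[R]_(d, n)) (s : seq 'I_n) :
  let Q := projcols M s in
  [/\ Q^T = Q, Q *m Q = Q, (forall k, k \in s -> Q *m col k M = 0) &
      exists C, 1%:M = Q + M *m C].
Proof.
elim: s => [|k s [QT QQ Qs [C QC]]] /=.
  by split=> //; rewrite ?trmx1 ?mulmx1//; exists 0; rewrite mulmx0 addr0.
set Q := projcols M s in QT QQ Qs QC *; set q := Q *m col k M.
set a := (dotc q q)^-1.
have qE : q = Q *m col k M by [].
clearbody q Q.
have Qq : Q *m q = q by rewrite qE mulmxA QQ.
have qQ : q^T *m Q = q^T by rewrite -{1}QT -trmx_mul Qq.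
have qcol l : q^T *m col l M = q^T *m (Q *m col l M) by rewrite mulmxA qQ.
split.
- by rewrite linearB linearZ /= QT trmx_mul trmxK.
- rewrite mulmxBr !mulmxBl QQ -!scalemxAr -!scalemxAl !mulmxA Qq.
  rewrite -[q *m q^T *m Q]mulmxA qQ -[q *m q^T *m q]mulmxA trmx_mul_dotc.
  rewrite mul_mx_scalar -scalemxAl !scalerA.
  have [d0|d0] := eqVneq (dotc q q) 0.
    by rewrite /a d0 invr0 !mul0r !scale0r !subr0.
  by rewrite /a mulfVK// subrr subr0.
- move=> l; rewrite inE mulmxBl -scalemxAl -mulmxA qcol => /predU1P[->|/Qs ->].
    rewrite -qE trmx_mul_dotc mul_mx_scalar scalerA.
    have [d0|d0] := eqVneq (dotc q q) 0; last by rewrite mulVf// scale1r subrr.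
    by move/eqP : d0; rewrite dotc_eq0 => /eqP ->; rewrite scaler0 subrr.
  by rewrite !mulmx0 scaler0 subrr.
- have -> : q = M *m (delta_mx k 0 - C *m col k M).
    rewrite mulmxBr -colE mulmxA qE; apply/eqP; rewrite eq_sym subr_eq.
    by rewrite -mulmxDl -QC mul1mx.
  exists (C + a *: ((delta_mx k 0 - C *m col k M) *m
    (M *m (delta_mx k 0 - C *m col k M))^T)).
  by rewrite mulmxDr -scalemxAr mulmxA addrA addrAC addrNK.
Qed.

Lemma projperp_projcols (R : realType) d n (M : 'M[R]_(d, n)) :
  projperp M = projcols M (enum 'I_n).
Proof.
have [QT QQ Qs [C QC]] := projcols_spec M (enum 'I_n).
apply: projperp_unique QC; apply: trmx_inj; rewrite trmx_mul trmxK QT trmx0.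
by apply: eq_mulmx_delta => k; rewrite mul0mx -mulmxA -colE Qs// mem_enum.
Qed.

(** * Positive semi-definite matrices *)

Lemma dotc_mulmx_addZ (R : realType) n (A : 'M[R]_n) (x y : 'cV[R]_n) a :
  A^T = A ->
  dotc (x + a *: y) (A *m (x + a *: y)) =
  dotc x (A *m x) + 2 * a * dotc x (A *m y) + a ^+ 2 * dotc y (A *m y).
Proof.
move=> AT; have Axy : dotc y (A *m x) = dotc x (A *m y).
  by rewrite mulmx_dotc AT dotcC.
rewrite mulmxDr -scalemxAr dotcDr dotcZr ![dotc (_ + _) _]dotcC !dotcDr !dotcZr.
rewrite (dotcC _ x) (dotcC _ x) (dotcC _ y) (dotcC _ y) Axy; ring.
Qed.

(** Evaluating the form at [e_i + e_k] and [e_i - e_k] gives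
    [2 |A_ik| <= A_ii + A_kk], and the diagonal of A is nonnegative. *)
Lemma psd_entry_le_trace (R : realType) n (A : 'M[R]_n) (i k : 'I_n) :
  psd A -> `|A i k| <= \tr A.
Proof.
move=> [AT A0].
have dxy (x : 'cV[R]_n) : 0 <= dotc x (A *m x) by rewrite /dotc mulmxA A0.
have dE l l' : dotc (delta_mx l 0) (A *m delta_mx l' 0) = A l l'.
  by rewrite /dotc mulmxA delta_quadE.
have diag0 l : 0 <= A l l by rewrite -dE.
have trle l : A l l <= \tr A.
  by rewrite /mxtrace (bigD1 l)//= lerDl sumr_ge0.
have [<-|ik] := eqVneq i k; first by rewrite ger0_norm.
have tr2 : A i i + A k k <= \tr A.
  rewrite /mxtrace (bigD1 i)//= (bigD1 k) 1?eq_sym//= addrA lerDl.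
  by rewrite sumr_ge0.
have h1 := dxy (delta_mx i 0 + (-1) *: delta_mx k 0).
have h2 := dxy (delta_mx i 0 + 1 *: delta_mx k 0).
move: h1 h2 (diag0 i) (diag0 k); rewrite !dotc_mulmx_addZ// !dE => h1 h2 di dk.
rewrite ler_norml; apply/andP; split; lra.
Qed.

Lemma psdD (R : realType) n (A B : 'M[R]_n) : psd A -> psd B -> psd (A + B).
Proof.
move=> [AT A0] [BT B0]; split; first by rewrite linearD /= AT BT.
by move=> x; rewrite mulmxDr mulmxDl mxE addr_ge0.
Qed.

Lemma psd_mxtrace_ge0 (R : realType) n (A : 'M[R]_n) : psd A -> 0 <= \tr A.
Proof.
move=> [_ A0]; by apply: sumr_ge0 => i _; rewrite -delta_quadE.
Qed.

(** * Derivatives of C1 maps *)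

Lemma rV_linear_continuous (R : realType) K (V : normedModType R)
    (L : {linear 'rV[R]_K -> V}) : continuous L.
Proof.
have -> : (L : _ -> _) = fun y => \sum_i y 0 i *: L (delta_mx 0 i).
  apply/funext => y; rewrite {1}(row_sum_delta y) linear_sum.
  by apply: eq_bigr => i _; rewrite linearZ.
apply: continuous_big => //; first exact: add_continuous.
move=> i _ y; apply: (cvgZr_tmp (F := nbhs y)); exact: coord_continuous.
Qed.

Lemma diff_linear_comp (R : realType) d K (V : normedModType R)
    (L : {linear 'rV[R]_K -> V}) (f : 'rV[R]_d -> 'rV[R]_K) x :
  differentiable f x ->
  differentiable (L \o f) x /\ 'd (L \o f) x = L \o 'd f x :> (_ -> _).
Proof.
move=> df; have Lc := @rV_linear_continuous _ _ _ L.
have dL : differentiable L (f x) by exact: linear_differentiable.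
by split; [exact: differentiable_comp|rewrite diff_comp// diff_lin].
Qed.

Lemma C1_linear_comp (R : realType) d K (V : normedModType R)
    (L : {linear 'rV[R]_K -> V}) (f : 'rV[R]_d -> 'rV[R]_K) :
  C1 f -> C1 (L \o f).
Proof.
move=> [df cf]; split=> [x|v]; first by have [] := diff_linear_comp L (df x).
have -> : (fun x => 'd (L \o f) x v) = L \o (fun x => 'd f x v).
  by apply/funext => x; have [_ ->] := diff_linear_comp L (df x).
by move=> x; apply: continuous_comp; [exact: cf|exact: rV_linear_continuous].
Qed.

Lemma C1_others (R : realType) d m (j : 'I_m) (g : 'rV[R]_d -> 'rV[R]_m) :
  C1 g -> C1 (others j g).
Proof.
move=> gC1; have Llin : linear (col' j : 'rV[R]_m -> 'rV[R]_m.-1).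
  by move=> a x y; apply/rowP => i; rewrite !mxE.
pose sL := GRing.isLinear.Build _ _ _ _ _ Llin.
pose L : {linear 'rV[R]_m -> 'rV[R]_m.-1} := HB.pack (col' j) sL.
exact: (C1_linear_comp L).
Qed.

(** The gradient of G^T Phi is (J Phi) G. *)
Lemma gradient_linear_comb (R : realType) d K (Phi : 'rV[R]_d -> 'rV[R]_K)
    (G : 'cV[R]_K) x :
  differentiable Phi x ->
  gradient (fun y => (G^T *m (Phi y)^T) 0 0) x = 'J Phi x *m G.
Proof.
move=> dPhi; have Llin : linear (fun y : 'rV[R]_K => (G^T *m y^T) 0 0 : R^o).
  by move=> a y z; rewrite linearD linearZ mulmxDr -scalemxAr !mxE.
pose sL := GRing.isLinear.Build _ _ _ _ _ Llin.
pose L : {linear 'rV[R]_K -> R^o} := HB.pack (fun y : 'rV[R]_K => _) sL.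
have [dL EL] := diff_linear_comp L dPhi.
apply/colP => i; rewrite mxE (@deriveE _ _ _ (L \o Phi))// EL /=.
rewrite !mxE; apply: eq_bigr => k _.
by rewrite !mxE mulrC.
Qed.

(** * Measurability *)

(** Inversion is continuous away from 0, and every function is measurable on
    the singleton of 0. *)
Lemma measurable_fun_inv (R : realType) (disp : measure_display)
    (T : measurableType disp) (f : T -> R) :
  measurable_fun setT f -> measurable_fun setT (fun t => (f t)^-1).
Proof.
move=> mf; apply: (@measurableT_comp _ _ _ _ _ _ (@GRing.inv R)) => //.
rewrite -(setUv [set 0 : R]); apply/measurable_funU => //.
  by apply: measurableC.
split; first exact: measurable_fun_set1.
apply: open_continuous_measurable_fun; first exact/closed_openC/closed_eq.
by move=> x; rewrite inE => /eqP x0; exact: inv_continuous.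
Qed.

(** Entrywise measurability of a random matrix. *)
Definition measurable_mx (R : realType) (disp : measure_display)
    (T : measurableType disp) m n (A : T -> 'M[R]_(m, n)) :=
  forall i k, measurable_fun setT (fun t => A t i k).

Lemma measurable_mx_const (R : realType) (disp : measure_display)
    (T : measurableType disp) m n (A : 'M[R]_(m, n)) :
  measurable_mx (fun _ : T => A).
Proof. by move=> i k; exact: measurable_cst. Qed.

Lemma measurable_mxB (R : realType) (disp : measure_display)
    (T : measurableType disp) m n (A B : T -> 'M[R]_(m, n)) :
  measurable_mx A -> measurable_mx B -> measurable_mx (fun t => A t - B t).
Proof.
move=> mA mB i k; under eq_fun do rewrite !mxE.
exact: measurable_funB.
Qed.

Lemma measurable_mxZ (R : realType) (disp : measure_display)
    (T : measurableType disp) m n (a : T -> R) (A : T -> 'M[R]_(m, n)) :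
  measurable_fun setT a -> measurable_mx A ->
  measurable_mx (fun t => a t *: A t).
Proof.
move=> ma mA i k; under eq_fun do rewrite !mxE.
exact: measurable_funM.
Qed.

Lemma measurable_mxT (R : realType) (disp : measure_display)
    (T : measurableType disp) m n (A : T -> 'M[R]_(m, n)) :
  measurable_mx A -> measurable_mx (fun t => (A t)^T).
Proof. by move=> mA i k; under eq_fun do rewrite mxE; exact: mA. Qed.

Lemma measurable_mxM (R : realType) (disp : measure_display)
    (T : measurableType disp) m n p (A : T -> 'M[R]_(m, n))
    (B : T -> 'M[R]_(n, p)) :
  measurable_mx A -> measurable_mx B -> measurable_mx (fun t => A t *m B t).
Proof.
move=> mA mB i k; under eq_fun do rewrite mxE.
by apply: measurable_sum => l; exact: measurable_funM.
Qed.

Lemma measurable_dotc (R : realType) (disp : measure_display)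
    (T : measurableType disp) d (x y : T -> 'cV[R]_d) :
  measurable_mx x -> measurable_mx y ->
  measurable_fun setT (fun t => dotc (x t) (y t)).
Proof. by move=> mx my; apply: measurable_mxM => //; exact: measurable_mxT. Qed.

Lemma measurable_projperp (R : realType) (disp : measure_display)
    (T : measurableType disp) d n (M : T -> 'M[R]_(d, n)) :
  measurable_mx M -> measurable_mx (fun t => projperp (M t)).
Proof.
move=> mM; under eq_fun do rewrite projperp_projcols.
elim: (enum 'I_n) => [|k s ih] /=; first exact: measurable_mx_const.
have mq : measurable_mx (fun t => projcols (M t) s *m col k (M t)).
  by apply: measurable_mxM => // i l; under eq_fun do rewrite mxE; exact: mM.
apply: measurable_mxB => //; apply: measurable_mxZ.
  exact/measurable_fun_inv/measurable_dotc.
by apply: measurable_mxM => //; exact: measurable_mxT.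
Qed.

Lemma random_vector_continuous (R : realType) (disp : measure_display)
    (T : measurableType disp) d (X : T -> 'rV[R]_d) (f : 'rV[R]_d -> R) :
  random_vector X -> continuous f -> measurable_fun setT (f \o X).
Proof.
move=> mX /continuousP cf; apply: (measurability _ (RGenOpens.measurableE R)).
move=> _ [_ [a [b ->] <-]]; rewrite comp_preimage; apply: mX => //.
by apply: sub_sigma_algebra; exact/cf/interval_open.
Qed.

Lemma measurable_gradient (R : realType) (disp : measure_display)
    (T : measurableType disp) d (X : T -> 'rV[R]_d) (u : 'rV[R]_d -> R) :
  random_vector X -> C1 u -> measurable_mx (fun t => gradient u (X t)).
Proof.
move=> mX [du cu] i k; under eq_fun do rewrite mxE deriveE//.
exact: (random_vector_continuous mX (cu _)).
Qed.

Lemma measurable_jacobian (R : realType) (disp : measure_display)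
    (T : measurableType disp) d K (X : T -> 'rV[R]_d)
    (f : 'rV[R]_d -> 'rV[R]_K) :
  random_vector X -> C1 f -> measurable_mx (fun t => 'J f (X t)).
Proof.
move=> mX [df cf] i k; under eq_fun do rewrite mxE.
apply: (@random_vector_continuous _ _ _ _ _
  (fun x => 'd f x (delta_mx 0 i) 0 k)) => // x.
apply: (@continuous_comp _ _ _ (fun x => 'd f x (delta_mx 0 i))
  (fun M : 'rV[R]_K => M 0 k)); first exact: cf.
exact: coord_continuous.
Qed.

(** * Entrywise expectation *)

(** Entrywise integrability of a random matrix. *)
Definition integrable_mx (R : realType) (disp : measure_display)
    (T : measurableType disp) (P : probability T R) m n
    (A : T -> 'M[R]_(m, n)) :=
  forall i k, P.-integrable setT (EFin \o (fun t => A t i k)).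

Lemma expectation_bilinear (R : realType) (disp : measure_display)
    (T : measurableType disp) (P : probability T R) m n
    (A : T -> 'M[R]_(m, n)) (x : 'cV[R]_m) (y : 'cV[R]_n) :
  integrable_mx P A ->
  'E_P[fun t => ((x^T *m A t *m y) 0 0)%R]%E = ((x^T *m Emx P A *m y) 0 0)%:E.
Proof.
move=> iA; rewrite mx_bilinearE unlock.
under eq_integral do rewrite mx_bilinearE -sumEFin.
rewrite integral_sum//=; last first.
  move=> p; under eq_fun do rewrite EFinM; apply: integrableZl => //; exact: iA.
rewrite -sumEFin; apply: eq_bigr => p _.
under eq_integral do rewrite EFinM.
rewrite integralZl//; last exact: iA.
by rewrite mxE unlock [RHS]EFinM fineK//; apply: integrable_fin_num => //; exact: iA.
Qed.

Lemma EmxB (R : realType) (disp : measure_display)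
    (T : measurableType disp) (P : probability T R) m n
    (A B : T -> 'M[R]_(m, n)) :
  integrable_mx P A -> integrable_mx P B ->
  Emx P A - Emx P B = Emx P (fun t => A t - B t).
Proof.
move=> iA iB; apply/matrixP => i k; rewrite !mxE unlock.
have -> : (\int[P]_t ((A t - B t) i k)%:E =
    \int[P]_t (A t i k)%:E - \int[P]_t (B t i k)%:E)%E.
  under eq_integral do rewrite !mxE EFinB.
  exact: integralB_EFin (iA i k) (iB i k).
rewrite [RHS]fineB//; exact: (integrable_fin_num _ (iA i k)) ||
  exact: (integrable_fin_num _ (iB i k)).
Qed.

Lemma integrable_mxB (R : realType) (disp : measure_display)
    (T : measurableType disp) (P : probability T R) m n
    (A B : T -> 'M[R]_(m, n)) :
  integrable_mx P A -> integrable_mx P B ->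
  integrable_mx P (fun t => A t - B t).
Proof.
move=> iA iB i k.
have -> : EFin \o (fun t => (A t - B t) i k) =
    ((EFin \o (fun t => A t i k)) \- (EFin \o (fun t => B t i k)))%E.
  by apply/funext => t /=; rewrite !mxE EFinB.
exact: integrableB.
Qed.

Lemma psd_Emx (R : realType) (disp : measure_display)
    (T : measurableType disp) (P : probability T R) n (A : T -> 'M[R]_n) :
  integrable_mx P A -> (forall t, psd (A t)) -> psd (Emx P A).
Proof.
move=> iA A0; split.
  apply/matrixP => i k; rewrite !mxE; congr (fine ('E_P[_]%E)).
  by apply/funext => t; have [AT _] := A0 t; rewrite -[in RHS]AT mxE.
move=> x; rewrite -lee_fin -expectation_bilinear//; apply: expectation_ge0 => t.
by have [_] := A0 t.
Qed.

(** Domination by the trace: for positive semi-definite random matrices, an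
    integrable bound on the trace suffices. *)
Lemma integrable_psd (R : realType) (disp : measure_display)
    (T : measurableType disp) (P : probability T R) n (A : T -> 'M[R]_n)
    (N : T -> R) :
  P.-integrable setT (EFin \o N) -> measurable_mx A ->
  (forall t, psd (A t)) -> (forall t, \tr (A t) <= N t) ->
  integrable_mx P A.
Proof.
move=> iN mA A0 AN i k; apply: (le_integrable _ _ _ iN) => //.
  exact/measurable_EFinP/mA.
move=> t _ /=; rewrite lee_fin (le_trans (psd_entry_le_trace _ _ (A0 t)))//.
by rewrite (le_trans (AN t))// ler_norm.
Qed.

(** * The integrands *)

(** The matrix |v|^2 B^T Q B whose expectation is H1, as a function of the
    point x: B is the Jacobian of Phi at x, Q the projector onto the orthogonal
    complement of the columns of the Jacobian of g', and v = Q grad u. *)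
Definition H1_integrand (R : realType) d K n (u : 'rV[R]_d -> R)
    (Phi : 'rV[R]_d -> 'rV[R]_K) (g' : 'rV[R]_d -> 'rV[R]_n) (x : 'rV[R]_d) :
    'M[R]_K :=
  norm2 (projperp ('J g' x) *m gradient u x) ^+ 2 *:
    (('J Phi x)^T *m projperp ('J g' x) *m 'J Phi x).

(** The matrix B^T v v^T B whose expectation is H2, with the same B and v. *)
Definition H2_integrand (R : realType) d K n (u : 'rV[R]_d -> R)
    (Phi : 'rV[R]_d -> 'rV[R]_K) (g' : 'rV[R]_d -> 'rV[R]_n) (x : 'rV[R]_d) :
    'M[R]_K :=
  ('J Phi x)^T *m vvec u g' x *m (vvec u g' x)^T *m 'J Phi x.

Lemma H1_integrand_quad (R : realType) d K n (u : 'rV[R]_d -> R)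
    (Phi : 'rV[R]_d -> 'rV[R]_K) (g' : 'rV[R]_d -> 'rV[R]_n) (x : 'rV[R]_d)
    (G : 'cV[R]_K) :
  let v := vvec u g' x in
  let w := projperp ('J g' x) *m ('J Phi x *m G) in
  (G^T *m H1_integrand u Phi g' x *m G) 0 0 = dotc v v * dotc w w.
Proof.
rewrite /= /H1_integrand norm2_sqr -scalemxAr -scalemxAl mxE; congr (_ * _).
by rewrite dotc_projperp /dotc trmx_mul !mulmxA.
Qed.

Lemma H2_integrand_quad (R : realType) d K n (u : 'rV[R]_d -> R)
    (Phi : 'rV[R]_d -> 'rV[R]_K) (g' : 'rV[R]_d -> 'rV[R]_n) (x : 'rV[R]_d)
    (G : 'cV[R]_K) :
  let v := vvec u g' x in
  let w := projperp ('J g' x) *m ('J Phi x *m G) in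
  (G^T *m H2_integrand u Phi g' x *m G) 0 0 = dotc v w ^+ 2.
Proof.
rewrite /= /H2_integrand; have -> : dotc (vvec u g' x)
    (projperp ('J g' x) *m ('J Phi x *m G)) = dotc (vvec u g' x) ('J Phi x *m G).
  by rewrite {1}/vvec dotc_projperp mulmx_dotc trmx_projperp.
move: ('J Phi x) (vvec u g' x) => B v.
have -> : G^T *m (B^T *m v *m v^T *m B) *m G =
    (v^T *m (B *m G))^T *m (v^T *m (B *m G)).
  by rewrite !trmx_mul trmxK !mulmxA.
by rewrite trmx_mul_dotc tr_scalar_mx -scalar_mxM mxE expr2.
Qed.

Lemma psd_H2_integrand (R : realType) d K n (u : 'rV[R]_d -> R)
    (Phi : 'rV[R]_d -> 'rV[R]_K) (g' : 'rV[R]_d -> 'rV[R]_n) (x : 'rV[R]_d) :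
  psd (H2_integrand u Phi g' x).
Proof.
split; last by move=> G; rewrite H2_integrand_quad sqr_ge0.
by rewrite /H2_integrand !trmx_mul !trmxK !mulmxA.
Qed.

(** The quadratic form of the difference is the integrand of the loss. *)
Lemma loss_integrand_quad (R : realType) d K n (u : 'rV[R]_d -> R)
    (Phi : 'rV[R]_d -> 'rV[R]_K) (g' : 'rV[R]_d -> 'rV[R]_n) (x : 'rV[R]_d)
    (G : 'cV[R]_K) :
  let v := vvec u g' x in
  let w := projperp ('J g' x) *m ('J Phi x *m G) in
  (G^T *m (H1_integrand u Phi g' x - H2_integrand u Phi g' x) *m G) 0 0 =
  norm2 v ^+ 2 * norm2 (projperp v *m w) ^+ 2.
Proof.
rewrite /= !norm2_sqr dotc_projperp_col -H1_integrand_quad -H2_integrand_quad.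
by rewrite mulmxBr mulmxBl !mxE.
Qed.

Lemma psd_integrand (R : realType) d K n (u : 'rV[R]_d -> R)
    (Phi : 'rV[R]_d -> 'rV[R]_K) (g' : 'rV[R]_d -> 'rV[R]_n) (x : 'rV[R]_d) :
  psd (H1_integrand u Phi g' x - H2_integrand u Phi g' x).
Proof.
split; last by move=> G; rewrite loss_integrand_quad mulr_ge0// sqr_ge0.
rewrite linearB /=; have [-> _] := psd_H2_integrand u Phi g' x.
congr (_ - _); rewrite /H1_integrand linearZ /= !trmx_mul (trmxK ('J Phi x)).
by rewrite (trmx_projperp ('J g' x)) mulmxA.
Qed.

(** The projector contracts both grad u and each column of J Phi. *)
Lemma mxtrace_H1_integrand_le (R : realType) d K n (u : 'rV[R]_d -> R)
    (Phi : 'rV[R]_d -> 'rV[R]_K) (g' : 'rV[R]_d -> 'rV[R]_n) (x : 'rV[R]_d) :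
  \tr (H1_integrand u Phi g' x) <=
  norm2 (gradient u x) ^+ 2 * normF ('J Phi x) ^+ 2.
Proof.
rewrite normF_sqr mulr_sumr; apply: ler_sum => k _.
rewrite -(delta_quadE (H1_integrand u Phi g' x) k k).
rewrite H1_integrand_quad norm2_sqr -colE.
by rewrite ler_pM ?dotc_ge0// dotc_projperp_le.
Qed.

Lemma psd_H1_integrand (R : realType) d K n (u : 'rV[R]_d -> R)
    (Phi : 'rV[R]_d -> 'rV[R]_K) (g' : 'rV[R]_d -> 'rV[R]_n) (x : 'rV[R]_d) :
  psd (H1_integrand u Phi g' x).
Proof.
rewrite -[H1_integrand _ _ _ _](subrK (H2_integrand u Phi g' x)).
exact: psdD (psd_integrand _ _ _ _) (psd_H2_integrand _ _ _ _).
Qed.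

Lemma mxtrace_H2_integrand_le (R : realType) d K n (u : 'rV[R]_d -> R)
    (Phi : 'rV[R]_d -> 'rV[R]_K) (g' : 'rV[R]_d -> 'rV[R]_n) (x : 'rV[R]_d) :
  \tr (H2_integrand u Phi g' x) <=
  norm2 (gradient u x) ^+ 2 * normF ('J Phi x) ^+ 2.
Proof.
apply: le_trans (mxtrace_H1_integrand_le u Phi g' x).
by rewrite -subr_ge0 -linearB psd_mxtrace_ge0//; exact: psd_integrand.
Qed.

Lemma measurable_vvec (R : realType) (disp : measure_display)
    (T : measurableType disp) d n (X : T -> 'rV[R]_d) (u : 'rV[R]_d -> R)
    (g' : 'rV[R]_d -> 'rV[R]_n) :
  random_vector X -> C1 u -> C1 g' -> measurable_mx (fun t => vvec u g' (X t)).
Proof.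
move=> mX uC1 gC1; apply: measurable_mxM; last exact: measurable_gradient.
exact/measurable_projperp/measurable_jacobian.
Qed.

Lemma measurable_H1_integrand (R : realType) (disp : measure_display)
    (T : measurableType disp) d K n (X : T -> 'rV[R]_d) (u : 'rV[R]_d -> R)
    (Phi : 'rV[R]_d -> 'rV[R]_K) (g' : 'rV[R]_d -> 'rV[R]_n) :
  random_vector X -> C1 u -> C1 Phi -> C1 g' ->
  measurable_mx (fun t => H1_integrand u Phi g' (X t)).
Proof.
move=> mX uC1 PhiC1 gC1; have mJ := measurable_jacobian mX PhiC1.
have mv := measurable_vvec mX uC1 gC1.
apply: measurable_mxZ.
  by under eq_fun do rewrite norm2_sqr; exact: measurable_dotc.
apply: measurable_mxM => //; apply: measurable_mxM; first exact: measurable_mxT.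
exact/measurable_projperp/measurable_jacobian.
Qed.

Lemma measurable_H2_integrand (R : realType) (disp : measure_display)
    (T : measurableType disp) d K n (X : T -> 'rV[R]_d) (u : 'rV[R]_d -> R)
    (Phi : 'rV[R]_d -> 'rV[R]_K) (g' : 'rV[R]_d -> 'rV[R]_n) :
  random_vector X -> C1 u -> C1 Phi -> C1 g' ->
  measurable_mx (fun t => H2_integrand u Phi g' (X t)).
Proof.
move=> mX uC1 PhiC1 gC1; have mJ := measurable_jacobian mX PhiC1.
have mv := measurable_vvec mX uC1 gC1.
apply: measurable_mxM => //; apply: measurable_mxM; last exact: measurable_mxT.
by apply: measurable_mxM => //; exact: measurable_mxT.
Qed.

Lemma integrable_sqr_gradient_jacobian (R : realType) (disp : measure_display)
    (T : measurableType disp) (P : probability T R) d K (X : T -> 'rV[R]_d)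
    (u : 'rV[R]_d -> R) (Phi : 'rV[R]_d -> 'rV[R]_K) :
  random_vector X -> C1 u -> C1 Phi ->
  let N t := norm2 (gradient u (X t)) ^+ 2 * normF ('J Phi (X t)) ^+ 2 in
  ('E_P[N] < +oo)%E -> P.-integrable setT (EFin \o N).
Proof.
move=> mX uC1 PhiC1 N Noo; apply/integrableP; split.
  apply/measurable_EFinP; rewrite /N.
  under eq_fun do rewrite norm2_sqr normF_sqr.
  have mJ := measurable_jacobian mX PhiC1.
  have mD := measurable_gradient mX uC1.
  apply: measurable_funM; first exact: measurable_dotc.
  have mc k : measurable_mx (fun t => col k ('J Phi (X t))).
    by move=> i l; under eq_fun do rewrite mxE; exact: mJ.
  by apply: measurable_sum => k; exact: measurable_dotc.
move: Noo; rewrite unlock; apply: le_lt_trans.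
rewrite le_eqVlt; apply/orP; left; apply/eqP; apply: eq_integral => t _ /=.
by rewrite ger0_norm// mulr_ge0// sqr_ge0.
Qed.

(** * The quadratic form of the loss *)

Theorem proposition5p5 (R : realType) (disp : measure_display)
    (T : measurableType disp) (P : probability T R)
    (d m K : nat) (X : T -> 'rV[R]_d)
    (u : 'rV[R]_d -> R) (Phi : 'rV[R]_d -> 'rV[R]_K)
    (Gm : set ('rV[R]_d -> 'rV[R]_m)) (j : 'I_m)
    (X_rv : random_vector X)
    (u_C1 : C1 u) (Phi_C1 : C1 Phi)
    (Gm_C1 : forall g, Gm g -> C1 g)
    (u_Phi_fin :
      ('E_P[fun t => (norm2 (gradient u (X t)) ^+ 2 *
                      normF ('J Phi (X t)) ^+ 2)%R] < +oo)%E)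
    (g : 'rV[R]_d -> 'rV[R]_m) (g_Gm : Gm g) :
  psd (H P X u Phi (others j g)) /\
  forall (h : 'rV[R]_d -> 'rV[R]_m) (G : 'cV[R]_K),
    same_others Gm j g h ->
    (forall x, h x 0 j = (G^T *m (Phi x)^T) 0 0) ->
    loss P X u j h = ((G^T *m H P X u Phi (others j g) *m G) 0 0)%:E.
Proof.
have gC1 : C1 (others j g) by exact/C1_others/Gm_C1.
set g' := others j g in gC1 *.
have iN := integrable_sqr_gradient_jacobian X_rv u_C1 Phi_C1 u_Phi_fin.
have i1 : integrable_mx P (fun t => H1_integrand u Phi g' (X t)).
  apply: (integrable_psd iN); first exact: measurable_H1_integrand.
    by move=> t; exact: psd_H1_integrand.
  by move=> t; exact: mxtrace_H1_integrand_le.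
have i2 : integrable_mx P (fun t => H2_integrand u Phi g' (X t)).
  apply: (integrable_psd iN); first exact: measurable_H2_integrand.
    by move=> t; exact: psd_H2_integrand.
  by move=> t; exact: mxtrace_H2_integrand_le.
have HE : H P X u Phi g' =
    Emx P (fun t => H1_integrand u Phi g' (X t) - H2_integrand u Phi g' (X t)).
  exact: EmxB.
have i12 := integrable_mxB i1 i2.
rewrite HE; split; first by apply: psd_Emx => // t; exact: psd_integrand.
move=> h G [_ hg'] hG; rewrite -expectation_bilinear//; congr ('E_P[_]%E).
apply/funext => t; rewrite loss_integrand_quad /wvec hg'.
have -> : (fun y => h y 0 j) = (fun y => (G^T *m (Phi y)^T) 0 0).
  by apply/funext => y; rewrite hG.
by rewrite gradient_linear_comb//; have [] := Phi_C1.
Qed.
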